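(* An ri function norm $R$ admits the representation \[ R(X)=\sup\left\{\int_0^1X^*(\omega)Y^*(\omega)\,d\omega:\ \mathbb{E}[Y]=R'(Y)=1,\ Y\in\mathcal{M}^+\right\}\quad\text{for all }X\in\mathcal{M}^+ \] if and only if $R$ is positive translation equivariant.
   Context: $\Omega=[0,1]$ with Lebesgue measure $\mu$, $\mathbb{E}[Y]=\int_0^1Y\,d\mu$; $\mathcal{M}^+$ is the set of measurable functions with values in $[0,\infty]$. A Banach function norm is $R:\mathcal{M}^+\to[0,\infty]$ with: $R(X)=0\iff X=0$, positive homogeneity, subadditivity; monotonicity; Fatou property ($0\le X_n\uparrow X$ a.e. $\Rightarrow R(X_n)\uparrow R(X)$); $R(\chi_E)<\infty$ and $\int_EX\,d\mu\le c_ER(X)$ for a constant $c_E$ depending only on $E,R$; normalised $R(\chi_\Omega)=1$. It is an ri function norm if $R(X)=R(Y)$ whenever $X,Y$ are equimeasurable ($\mu\{|X|>\lambda\}=\mu\{|Y|>\lambda\}$ for all $\lambda\ge0$). Decreasing rearrangement: $X^*(\omega)=\inf\{\lambda\ge0:\mu\{|X|>\lambda\}\le\omega\}$. Associate norm: $R'(X)=\sup\{\int_0^1X^*Y^*\,d\omega: R(Y)\le1,\ Y\in\mathcal{M}^+\}$. $R$ is positive translation equivariant if $R(X+c)=R(X)+c$ for all $X\in\mathcal{M}^+$, $c\in\mathbb{R}$ with $X+c\ge0$. *)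

(* Defs.v *)
From HB Require Import structures.
From mathcomp Require Import all_boot all_order all_algebra.
From mathcomp Require Import all_classical all_reals all_analysis measurable_realfun.
Set Implicit Arguments. Unset Strict Implicit. Unset Printing Implicit Defensive.
Import Order.TTheory GRing.Theory Num.Theory.
Local Open Scope classical_set_scope.
Local Open Scope ring_scope.
Local Open Scope ereal_scope.

Section Defs.
Variable R : realType.

Definition Omega : set R := `[0%R, 1%R].
Definition mu := (@lebesgue_measure R).

(* M^+ : measurable functions Omega -> [0, +oo] (values outside Omega irrelevant) *)
Definition Mplus (X : R -> \bar R) : Prop :=
  measurable_fun Omega X /\ (forall w, Omega w -> 0 <= X w).

Definition chi (E : set R) : R -> \bar R := fun w => (\1_E w)%:E.

Definition banach_function_norm (rho : (R -> \bar R) -> \bar R) : Prop :=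
  (forall X, Mplus X -> 0 <= rho X) /\
  (forall X, Mplus X -> (rho X = 0 <-> {ae mu, forall w, Omega w -> X w = 0})) /\
  (forall X (a : R), Mplus X -> (0 <= a)%R -> rho (fun w => a%:E * X w) = a%:E * rho X) /\
  (forall X Y, Mplus X -> Mplus Y -> rho (fun w => X w + Y w) <= rho X + rho Y) /\
  (forall X Y, Mplus X -> Mplus Y -> {ae mu, forall w, Omega w -> X w <= Y w} ->
     rho X <= rho Y) /\
  (forall (Xs : nat -> R -> \bar R) X, (forall n, Mplus (Xs n)) -> Mplus X ->
     {ae mu, forall w, Omega w ->
        {homo (fun n => Xs n w) : m n / (m <= n)%N >-> m <= n} /\
        (fun n => Xs n w) @ \oo --> X w} ->
     (fun n => rho (Xs n)) @ \oo --> rho X) /\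
  (forall E, measurable E -> E `<=` Omega ->
     rho (chi E) < +oo /\
     exists cE : R, forall X, Mplus X -> \int[mu]_(w in E) X w <= cE%:E * rho X) /\
  rho (chi Omega) = 1.

Definition equimeasurable (X Y : R -> \bar R) : Prop :=
  forall l : R, (0 <= l)%R ->
    mu [set w | Omega w /\ l%:E < `|X w|] = mu [set w | Omega w /\ l%:E < `|Y w|].

Definition ri_function_norm (rho : (R -> \bar R) -> \bar R) : Prop :=
  banach_function_norm rho /\
  (forall X Y, Mplus X -> Mplus Y -> equimeasurable X Y -> rho X = rho Y).

Definition rearr (X : R -> \bar R) (w : R) : \bar R :=
  ereal_inf [set l%:E | l in [set l : R | (0 <= l)%R /\
     mu [set x | Omega x /\ l%:E < `|X x|] <= w%:E]].

Definition pairing (X Y : R -> \bar R) : \bar R :=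
  \int[mu]_(w in Omega) (rearr X w * rearr Y w).

Definition assoc_norm (rho : (R -> \bar R) -> \bar R) (X : R -> \bar R) : \bar R :=
  ereal_sup [set pairing X Y | Y in [set Y | Mplus Y /\ rho Y <= 1]].

Definition expectation (Y : R -> \bar R) : \bar R := \int[mu]_(w in Omega) Y w.

Definition pos_translation_equivariant (rho : (R -> \bar R) -> \bar R) : Prop :=
  forall X (c : R), Mplus X -> (forall w, Omega w -> 0 <= X w + c%:E) ->
    rho (fun w => X w + c%:E) = rho X + c%:E.

Definition has_representation (rho : (R -> \bar R) -> \bar R) : Prop :=
  forall X, Mplus X ->
    rho X = ereal_sup [set pairing X Y | Y in
      [set Y | Mplus Y /\ expectation Y = 1 /\ assoc_norm rho Y = 1]].

End Defs.

(* Main.v *)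
(* If the representation holds, then (X + c)^* = X^* + c and int Y^* = E[Y] = 1 give
   translation equivariance. Conversely, X^* is an increasing limit of decreasing
   dyadic step functions, so by the Fatou property it suffices to norm, up to epsilon,
   a step function with decreasing coefficients x. On step functions with N cells rho
   is a finite-dimensional symmetric norm; the Hahn-Banach theorem at x + 1 yields
   coefficients y >= 0 norming x + 1, and R(x + 1) = R(x) + 1 forces y to have mean 1
   and to norm x as well. The step function Y with coefficients y satisfies R'(Y) <= 1,
   because averaging a step function over the cells of a coarser partition does not
   increase R: the average is a mean of equimeasurable functions. *)
Require Import Defs.
From mathcomp Require Import all_boot all_order all_algebra.
From mathcomp Require Import all_classical all_reals all_analysis measurable_realfun.
From mathcomp Require Import lra.
Set Implicit Arguments. Unset Strict Implicit. Unset Printing Implicit Defensive.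
Import Order.TTheory GRing.Theory Num.Theory.
Local Open Scope classical_set_scope.
Local Open Scope ring_scope.

(** * Hahn-Banach in finite dimension *)

Section sublinear_functionals.
Context {R : realType} {V : lmodType R}.
Implicit Types p q : V -> R.

Definition sublinear p :=
  (forall u v, p (u + v) <= p u + p v) /\
  (forall a u, 0 <= a -> p (a *: u) = a * p u).

Lemma sublinear0 {p} : sublinear p -> p 0 = 0.
Proof. by case=> _ pZ; rewrite -(scale0r 0) pZ// mul0r. Qed.

Lemma sublinearN_ge {p} u : sublinear p -> - p (- u) <= p u.
Proof.
move=> sp; have := sp.1 u (- u); rewrite subrr sublinear0//; lra.
Qed.

(* q z = inf_(t >= 0) (p (z + t e) - t p(e)). *)
Lemma sublinear_odd_minorant p e : sublinear p ->
  exists q, [/\ sublinear q, forall z, q z <= p z, q e = p e & q (- e) = - p e].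
Proof.
move=> sp; have [pD pZ] := sp.
pose S z := [set p (z + t *: e) - t * p e | t in [set t : R | 0 <= t]].
pose q z := inf (S z).
(* The infimum is finite, since t p(e) = p(t e) <= p(z + t e) + p(-z). *)
have lbS z : lbound (S z) (- p (- z)).
  move=> _ [t /= t0 <-]; rewrite -pZ//.
  have := pD (z + t *: e) (- z); rewrite (addrC z) addrK; lra.
have qle z t : 0 <= t -> q z <= p (z + t *: e) - t * p e.
  by move=> t0; apply: ge_inf; [exists (- p (- z)); exact: lbS | exists t].
have q_ge z c : (forall t, 0 <= t -> c <= p (z + t *: e) - t * p e) -> c <= q z.
  move=> H; apply: lb_le_inf; first by exists (p (z + 0 *: e) - 0 * p e); exists 0 => /=.
  by move=> _ [t /= t0 <-]; exact: H.
have qp z : q z <= p z.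
  by have := qle z 0 (lexx _); rewrite scale0r addr0 mul0r subr0.
have qD u v : q (u + v) <= q u + q v.
  rewrite -lerBlDr; apply: (q_ge _ _) => t t0.
  rewrite lerBlDr -lerBlDl; apply: (q_ge _ _) => s s0.
  have := qle (u + v) (t + s) (addr_ge0 t0 s0).
  have := pD (u + t *: e) (v + s *: e).
  by rewrite scalerDl addrACA mulrDl; lra.
have qZle a u : 0 < a -> q (a *: u) <= a * q u.
  move=> a0; rewrite mulrC -ler_pdivrMr//; apply: (q_ge _ _) => t t0.
  rewrite ler_pdivrMr//.
  have := qle (a *: u) (a * t) (mulr_ge0 (ltW a0) t0).
  rewrite -scalerA -scalerDr pZ ?(ltW a0)// => /le_trans; apply.
  by rewrite -mulrA -mulrBr mulrC.
have q0 : q 0 = 0.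
  apply/eqP; rewrite eq_le; apply/andP; split.
    by have := qp 0; rewrite (sublinear0 sp).
  apply: (q_ge _ _) => t t0; rewrite add0r pZ// subrr//.
have qZ a u : 0 <= a -> q (a *: u) = a * q u.
  rewrite le0r => /predU1P[->|a0]; first by rewrite scale0r mul0r q0.
  apply/eqP; rewrite eq_le qZle//=.
  have := qZle a^-1 (a *: u); rewrite invr_gt0 a0 scalerA mulVf ?gt_eqF// scale1r.
  by move=> /(_ isT); rewrite mulrC ler_pdivlMr// mulrC.
have sq : sublinear q by [].
(* Taking t = 1 gives q(-e) <= -p(e); then p(e) <= -q(-e) <= q(e) <= p(e) forces equality
   throughout. *)
have qNe : q (- e) <= - p e.
  have := qle (- e) 1 ler01; rewrite scale1r addNr (sublinear0 sp) mul1r; lra.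
have := sublinearN_ge e sq; have := qp e => h1 h2.
by exists q; split=> //; lra.
Qed.

(** Oddness at a vector survives the passage to a smaller sublinear functional: q(-e) <= p1(-e) =
    -p1(e) <= -q(e) <= q(-e). The vectors can therefore be treated one after another. *)
Lemma sublinear_odd_minorant_seq p (s : seq V) : sublinear p ->
  exists q, [/\ sublinear q, forall z, q z <= p z &
    forall v, v \in s -> q (- v) = - q v].
Proof.
elim: s p => [|e s IH] p sp; first by exists p; split=> // z; rewrite lexx.
have [p1 [sp1 p1p p1e p1Ne]] := sublinear_odd_minorant e sp.
have [q [sq qp1 qs]] := IH p1 sp1.
exists q; split=> // [z|v]; first exact: le_trans (qp1 z) (p1p z).
rewrite inE => /predU1P[->|/qs//].
have := sublinearN_ge e sq; have := qp1 e; have := qp1 (- e); lra.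
Qed.

End sublinear_functionals.

(** The functional is first made odd at x, which fixes its value there, and then at every basis
    vector. A sublinear functional that is odd on a basis is linear on its span, and [y] collects
    its values on the basis. *)
Lemma finite_hahn_banach {R : realType} (N : nat) (p : (nat -> R) -> R) (x : nat -> R) :
  (forall u v, p (fun i => u i + v i) <= p u + p v) ->
  (forall a u, 0 <= a -> p (fun i => a * u i) = a * p u) ->
  (forall u v, (forall i, (i < N)%N -> u i = v i) -> p u = p v) ->
  exists y : nat -> R,
    (forall z : nat -> R, \sum_(i < N) y i * z i <= p z) /\ \sum_(i < N) y i * x i = p x.
Proof.
move=> pD pZ ploc.
have sp : @sublinear R (nat -> R^o) p by split.
pose e (i : nat) : nat -> R^o := fun j => (j == i)%:R.
pose x' : nat -> R^o := \sum_(i < N) x i *: e i.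
have [p1 [sp1 p1p p1x p1Nx]] := sublinear_odd_minorant x' sp.
have [q [sq qp1 qs]] := sublinear_odd_minorant_seq [seq e i | i <- iota 0 N] sp1.
have [qD qZ] := sq.
have qZN a i : (i < N)%N -> q (a *: e i) = a * q (e i).
  move=> iN; have [a0|a0] := leP 0 a; first exact: qZ.
  rewrite -[a]opprK scaleNr -scalerN qZ ?oppr_ge0 ?ltW//.
  by rewrite qs ?mulrN ?mulNr//; apply: map_f; rewrite mem_iota.
have qsum (z : nat -> R) : \sum_(i < N) q (e i) * z i = q (\sum_(i < N) z i *: e i).
  have h (z' : nat -> R) : q (\sum_(i < N) z' i *: e i) <= \sum_(i < N) q (e i) * z' i.
    elim/big_ind2 : _ => [|u1 a1 u2 a2 h1 h2|i _].
    - by rewrite (sublinear0 sq).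
    - exact: le_trans (qD _ _) (lerD h1 h2).
    - by rewrite qZN// mulrC.
  apply/eqP; rewrite eq_le h andbT.
  (* The reverse inequality is [h] at -z combined with -q(-u) <= q(u). *)
  have := h (fun i => - z i).
  under [X in q X]eq_bigr do rewrite scaleNr.
  under [leRHS]eq_bigr do rewrite mulrN.
  rewrite !sumrN lerNr => /le_trans; apply.
  exact: sublinearN_ge.
have scE (a : R) i j : (a *: e i) j = a * (j == i)%:R :> R by [].
have zE (z : nat -> R) : p (\sum_(i < N) z i *: e i) = p z.
  apply: ploc => i iN; rewrite fct_sumE (bigD1 (Ordinal iN))//= big1 ?addr0.
    by rewrite scE eqxx mulr1.
  move=> j /eqP ji; rewrite scE (_ : (i == j) = false) ?mulr0//.
  by apply/eqP => ij; apply: ji; exact/val_inj.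
exists (q \o e); split=> [z|]; rewrite /= qsum.
  by rewrite -(zE z); exact: le_trans (qp1 _) (p1p _).
(* Oddness of [p1] at x' leaves no freedom: p(x') = -p1(-x') <= -q(-x') <= q(x') <= p1(x') =
   p(x'). *)
have qx : q x' <= p1 x' by exact: qp1.
have qNx : q (- x') <= p1 (- x') by exact: qp1.
have := sublinearN_ge x' sq; rewrite -[RHS]zE.
by rewrite -/x'; lra.
Qed.

Local Open Scope ereal_scope.

(** By counting, an injective self-map of the first N indices is a permutation of them. *)
Lemma sum_reindex_nat {V : nmodType} (N : nat) (s : nat -> nat) (F : nat -> V) :
  (forall i, (i < N)%N -> (s i < N)%N) ->
  {in [pred i | (i < N)%N] &, injective s} ->
  (\sum_(i < N) F (s i) = \sum_(i < N) F i)%R.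
Proof.
move=> sN sinj; rewrite -(big_mkord xpredT (fun i => F (s i))) -(big_mkord xpredT F).
rewrite -(big_map s xpredT F); apply: perm_big.
rewrite /index_iota subn0.
have us : uniq [seq s i | i <- iota 0 N].
  rewrite map_inj_in_uniq ?iota_uniq// => i j; rewrite !mem_iota/= !add0n.
  exact: sinj.
apply: uniq_perm => //; first exact: iota_uniq.
apply: (uniq_min_size us _ _).2; last by rewrite size_map.
by move=> _ /mapP[i + ->]; rewrite !mem_iota/= !add0n; exact: sN.
Qed.

(** * Step functions on uniform partitions of [0,1[ *)

Section step_functions.
Context {R : realType}.
Local Notation mu := (@mu R).
Local Notation Omega := (@Omega R).
Implicit Types (x y z : nat -> R) (N : nat).

Lemma measurable_Omega : measurable Omega.
Proof. exact: measurable_itv. Qed.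

Lemma mu_Omega : mu Omega = 1.
Proof. by rewrite /Defs.mu /Defs.Omega lebesgue_measure_itv/= lte_fin ltr01 oppr0 adde0. Qed.

(* Extended by 0 outside [0,1[, in particular at 1, where every rearrangement vanishes. *)
Definition step N x (w : R) : \bar R :=
  if (0 <= w < 1)%R then (x (Num.truncn (N%:R * w)))%:E else 0.

Definition cell N (i : nat) : set R := `[(i%:R / N%:R)%R, (i.+1%:R / N%:R)%R[.

Lemma cellE N i (w : R) : (0 < N)%N ->
  cell N i w <-> (i%:R <= N%:R * w < i.+1%:R)%R.
Proof.
move=> N0; rewrite /cell/= in_itv/= ler_pdivrMr ?ltr0n// ltr_pdivlMr ?ltr0n//.
by rewrite (mulrC w).
Qed.

Lemma cell_lt_one N i (w : R) : (i < N)%N -> cell N i w -> (0 <= w < 1)%R.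
Proof.
move=> iN; have N0 : (0 < N)%N by exact: leq_ltn_trans iN.
move=> /cellE-/(_ N0)/andP[h1 h2]; apply/andP; split.
  by rewrite -(@pmulr_rge0 _ N%:R) ?ltr0n// (le_trans _ h1).
by rewrite -(@ltr_pM2l _ N%:R) ?ltr0n// mulr1 (lt_le_trans h2)// ler_nat.
Qed.

Lemma cell_truncn N (w : R) : (0 < N)%N -> (0 <= w < 1)%R ->
  cell N (Num.truncn (N%:R * w)%R) w /\ (Num.truncn (N%:R * w)%R < N)%N.
Proof.
move=> N0 /andP[w0 w1].
have Nw0 : (0 <= N%:R * w)%R by rewrite mulr_ge0.
split; first by apply/cellE => //; exact: truncn_itv.
rewrite -(ltr_nat R); apply: (@le_lt_trans _ _ (N%:R * w)%R).
  by have /andP[] := truncn_itv Nw0.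
by rewrite gtr_pMr ?ltr0n.
Qed.

Lemma cell_stepE {N i x w} : (i < N)%N -> cell N i w -> step N x w = (x i)%:E.
Proof.
move=> iN wi; have := cell_lt_one iN wi; have N0 : (0 < N)%N by exact: leq_ltn_trans iN.
rewrite /step => w01; rewrite w01; congr (x _)%:E; apply/eqP.
by rewrite truncn_eq; [exact/cellE|rewrite mulr_ge0//; case/andP: w01].
Qed.

Lemma step_ind N x (P : R -> \bar R -> Prop) : (0 < N)%N ->
  (forall w, ~ (0 <= w < 1)%R -> P w 0) ->
  (forall i w, (i < N)%N -> (0 <= w < 1)%R -> cell N i w -> P w (x i)%:E) ->
  forall w, P w (step N x w).
Proof.
move=> N0 H0 H w; have [w01|/negP w01] := boolP (0 <= w < 1)%R.
  have [wi iN] := cell_truncn N0 w01.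
  by rewrite (cell_stepE iN wi); exact: H.
by rewrite /step ifN; [exact: H0|exact/negP].
Qed.

Lemma step_sum N x w : (0 < N)%N ->
  step N x w = \sum_(i < N) ((x i)%:E * (\1_(cell N i) w)%:E).
Proof.
move=> N0; apply/esym; have [w01|/negP w01] := boolP (0 <= w < 1)%R.
  have [wi iN] := cell_truncn N0 w01; set i0 := Num.truncn _ in wi iN.
  rewrite (bigD1 (Ordinal iN))//= big1 ?adde0.
    by rewrite (cell_stepE iN wi) indicE mem_set ?mule1.
  move=> j ji; rewrite indicE memNset ?mule0// => wj; move/eqP: ji; apply.
  (* The step function with coefficients [i%:R] reads off the index of the cell, so two cells
     containing [w] coincide. *)
  have := cell_stepE (x := fun i => i%:R) (ltn_ord j) wj.
  rewrite (cell_stepE iN wi) => -[] /eqP; rewrite eqr_nat => /eqP i0j.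
  exact/val_inj.
rewrite big1 ?/step ?ifN//; first exact/negP.
by move=> i _; rewrite indicE memNset ?mule0// => /(cell_lt_one (ltn_ord i)).
Qed.

Lemma measurable_step N x (D : set R) : (0 < N)%N -> measurable_fun D (step N x).
Proof.
move=> N0; rewrite (funext (fun w => step_sum x w N0)).
apply: emeasurable_sum => i; apply: measurable_funeM.
by apply/measurable_EFinP; apply: measurable_indic; exact: measurable_itv.
Qed.

Lemma step_ge0 N x w : (0 < N)%N -> (forall i, 0 <= x i)%R -> 0 <= step N x w.
Proof. by move=> N0 x0; rewrite /step; case: ifP; rewrite ?lee_fin. Qed.

Lemma step_Mplus N x : (0 < N)%N -> (forall i, 0 <= x i)%R -> Mplus (step N x).
Proof. by move=> N0 x0; split=> [|w _]; [exact: measurable_step|exact: step_ge0]. Qed.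

Lemma mu_cell N i : (0 < N)%N -> mu (cell N i) = (N%:R^-1)%:E.
Proof.
move=> N0; rewrite /Defs.mu /cell lebesgue_measure_itv/= lte_fin.
rewrite ltr_pM2r ?invr_gt0 ?ltr0n// ltr_nat ltnSn.
by rewrite -EFinB -mulrBl -natrB// subSnn mul1r.
Qed.

Lemma integral_step N x : (0 < N)%N -> (forall i, 0 <= x i)%R ->
  \int[mu]_(w in Omega) step N x w = ((\sum_(i < N) x i) / N%:R)%:E.
Proof.
move=> N0 x0; under eq_integral do rewrite step_sum//.
have mi i : measurable_fun Omega (fun w : R => (\1_(cell N i) w)%:E).
  by apply/measurable_EFinP; apply: measurable_indic; exact: measurable_itv.
rewrite ge0_integral_sum//; first last.
- by move=> i w _; rewrite -EFinM lee_fin mulr_ge0// indicE.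
- by move=> i; apply: measurable_funeM; exact: mi.
- exact: measurable_Omega.
rewrite mulr_suml -sumEFin; apply: eq_bigr => i _.
rewrite ge0_integralZl_EFin//; [|exact: measurable_Omega|exact: mi].
rewrite integral_indic//; [|exact: measurable_Omega|exact: measurable_itv].
rewrite setIidl; last first.
  move=> w /(cell_lt_one (ltn_ord i))/andP[w0 w1].
  by rewrite /Defs.Omega/= in_itv/= w0 ltW.
by rewrite -[X in _ * X]/(mu (cell N i)) mu_cell// -EFinM.
Qed.

(** On [Omega] the indicator of the level set is itself a step function, with coefficients the truth
    values of [l < x i]; since l >= 0, the default value 0 never exceeds l. *)
Lemma mu_step_gt N x (l : R) : (0 < N)%N -> (forall i, 0 <= x i)%R -> (0 <= l)%R ->
  mu [set w | Omega w /\ l%:E < `|step N x w|] =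
  ((\sum_(i < N) (l < x i)%R%:R) / N%:R)%:E.
Proof.
move=> N0 x0 l0; rewrite -(@integral_step N (fun i => (l < x i)%R%:R))//.
under eq_set => w do rewrite gee0_abs ?step_ge0//.
set A := [set w | _].
have mA : measurable A.
  apply: (@emeasurable_fun_o_infty _ _ _ _ _ measurable_Omega).
  exact: measurable_step.
rewrite -[A in LHS](@setIidl _ A Omega) => [|w []//].
rewrite -[LHS]/(lebesgue_measure (A `&` Omega)) -integral_indic//; last first.
  exact: measurable_Omega.
apply: eq_integral => w; rewrite inE => wO; rewrite indicE.
rewrite (_ : (w \in A) = (l%:E < step N x w)); last first.
  by apply/idP/idP => [|h]; rewrite inE => // -[].
by rewrite /step; case: ifP => _; rewrite lte_fin// ltNge l0.
Qed.

End step_functions.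

(** * Decreasing rearrangement *)

Section rearrangement.
Context {R : realType}.
Local Notation mu := (@mu R).
Local Notation Omega := (@Omega R).
Local Notation dist X l := (mu [set w | Omega w /\ l%:E < `|X w|]).
Implicit Types (X Y : R -> \bar R) (x y z : nat -> R) (N : nat).

(** Rearrangements are handled through their real upper bounds l >= 0 (see [rearr_le]), so
    comparisons in the extended line are reduced to such bounds. *)
Lemma le_ereal_nneg_ub (a b : \bar R) : 0 <= b ->
  (forall l : R, (0 <= l)%R -> b <= l%:E -> a <= l%:E) -> a <= b.
Proof.
case: b => [b| |].
- by rewrite lee_fin => b0; exact.
- by move=> _ _; rewrite leey.
- by rewrite leeNy_eq.
Qed.

Lemma eq_ereal_nneg_ub (a b : \bar R) : 0 <= a -> 0 <= b ->
  (forall l : R, (0 <= l)%R -> (a <= l%:E) = (b <= l%:E)) -> a = b.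
Proof.
move=> a0 b0 ab; apply: le_anti; apply/andP.
by split; apply: le_ereal_nneg_ub => // l l0; rewrite ab.
Qed.

Lemma measurable_gt X (l : R) : Mplus X ->
  measurable [set w | Omega w /\ l%:E < `|X w|].
Proof.
move=> [mX X0].
rewrite (_ : [set w | _] = Omega `&` [set w | l%:E < X w]).
  exact: (emeasurable_fun_o_infty measurable_Omega).
by apply/seteqP; split=> w [wO]; rewrite /= gee0_abs ?X0.
Qed.

Lemma dist_le1 X (l : R) : Mplus X -> dist X l <= 1.
Proof.
move=> MX; rewrite -(@mu_Omega R); apply: le_measure; rewrite ?inE.
- exact: measurable_gt.
- exact: measurable_Omega.
- by move=> w [].
Qed.

Lemma dist_fin X (l : R) : Mplus X -> dist X l = (fine (dist X l))%:E.
Proof.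
move=> MX; rewrite fineK// ge0_fin_numE; first exact: le_lt_trans (dist_le1 _ MX) (ltry 1).
exact: measure_ge0.
Qed.

Lemma rearr_ge0 X (w : R) : 0 <= rearr X w.
Proof. by apply: le_ereal_inf_tmp => _ [l [l0 _] <-]; rewrite lee_fin. Qed.

(** The distribution function is right-continuous, because the level set above l is the increasing
    union of those above l + 1/(n+1). Hence the infimum defining X^* is attained, and X^* and the
    distribution function form a Galois connection. *)
Lemma rearr_le X (w l : R) : Mplus X -> (0 <= l)%R ->
  (rearr X w <= l%:E) = (dist X l <= w%:E).
Proof.
move=> MX l0; apply/idP/idP => [h|h]; last first.
  by apply: ereal_inf_lbound; exists l.
pose F (n : nat) := [set u | Omega u /\ (l + n.+1%:R^-1)%:E < `|X u|].
have FE : \bigcup_n F n = [set u | Omega u /\ l%:E < `|X u|].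
  apply/seteqP; split=> [u [n _ [uO]]|u [uO lu]].
    move=> hn; split=> //; apply: lt_trans hn.
    by rewrite lte_fin ltrDl invr_gt0.
  have [r lr ru] : exists2 r, (l < r)%R & r%:E <= `|X u|.
    move: lu; case: `|X u| => [r||]//; first by rewrite lte_fin; exists r.
    by exists (l + 1)%R; rewrite ?leey// ltrDl.
  exists (Num.truncn (r - l)^-1) => //; split=> //; apply: lt_le_trans ru.
  rewrite lte_fin -ltrBrDl invf_plt ?posrE ?subr_gt0 ?ltr0n//.
  exact: truncnS_gt.
have cvgF : dist X (l + n.+1%:R^-1) @[n --> \oo] --> dist X l.
  rewrite -FE; apply: nondecreasing_cvg_mu.
  - by move=> n; exact: measurable_gt.
  - by rewrite FE; exact: measurable_gt.
  - move=> n m nm; apply/subsetPset => u [uO hu]; split=> //.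
    apply: le_lt_trans hu; rewrite lee_fin lerD2l lef_pV2 ?posrE ?ltr0n//.
    by rewrite ler_nat.
apply: (cvge_le _ cvgF); apply: nearW => n.
have : rearr X w < (l + n.+1%:R^-1)%:E.
  by apply: le_lt_trans h _; rewrite lte_fin ltrDl invr_gt0.
move=> /ereal_inf_lt[_ [l' [l'0 hl'] <-] /ltW ll'].
apply: le_trans hl'; apply: le_measure; rewrite ?inE; [exact: measurable_gt|exact: measurable_gt|].
by move=> u [uO hu]; split=> //; exact: le_lt_trans hu.
Qed.

Lemma rearr_gt X (w l : R) : Mplus X -> (0 <= l)%R ->
  (l%:E < rearr X w) = (w%:E < dist X l).
Proof. by move=> MX l0; rewrite !ltNge rearr_le. Qed.

Lemma rearr_nonincreasing X (w w' : R) : (w <= w')%R -> rearr X w' <= rearr X w.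
Proof.
move=> ww'; apply: le_ereal_inf_tmp => _ [l [l0 hl] <-].
by apply: ereal_inf_lbound; exists l => //; split=> //; exact: le_trans hl _.
Qed.

Lemma rearr_ge1 X (w : R) : Mplus X -> (1 <= w)%R -> rearr X w = 0.
Proof.
move=> MX w1; apply/eqP; rewrite eq_le rearr_ge0 andbT rearr_le//.
by apply: le_trans (dist_le1 _ MX) _; rewrite lee_fin.
Qed.

(** By the Galois connection, the level set of X^* above l is [0,d[ with d the measure of the level
    set of X. *)
Lemma equimeasurable_rearr X : Mplus X -> equimeasurable X (rearr X).
Proof.
move=> MX l l0; have d1 := dist_le1 l MX; have d0 : 0 <= dist X l by exact: measure_ge0.
have dE := dist_fin l MX; set d := fine _ in dE.
rewrite (_ : [set w | Omega w /\ l%:E < `|rearr X w|] = [set` `[0%R, d[]); last first.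
  apply/seteqP; split=> w /=; rewrite gee0_abs ?rearr_ge0 ?rearr_gt// dE lte_fin.
    by rewrite /Defs.Omega/= !in_itv/= => -[/andP[-> _] ->].
  rewrite /Defs.Omega/= !in_itv/= => /andP[-> wd]; split=> //=.
  by move: d1; rewrite dE lee_fin; apply: le_trans; exact: ltW.
rewrite dE /Defs.mu lebesgue_measure_itv/= lte_fin.
move: d0; rewrite dE lee_fin le0r => /predU1P[->|->]; first by rewrite ltxx.
by rewrite oppr0 adde0.
Qed.

End rearrangement.

(** * Dyadic approximation of rearrangements from below; rearrangements of steps, multiples and
    translates *)

Lemma sum_ltn_ord (k N : nat) : (k <= N)%N -> (\sum_(i < N) (i < k))%N = k.
Proof.
move=> kN; rewrite -big_mkcond/= (big_ord_narrow kN).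
by rewrite sum_nat_const card_ord muln1.
Qed.

Section approximation.
Context {R : realType}.
Local Notation mu := (@mu R).
Local Notation Omega := (@Omega R).
Local Notation dist X l := (mu [set w | Omega w /\ l%:E < `|X w|]).
Implicit Types (X Y : R -> \bar R) (x y z : nat -> R) (N : nat).

Lemma Omega_split (w : R) : Omega w -> (0 <= w < 1)%R \/ w = 1%R.
Proof.
rewrite /Defs.Omega/= in_itv/= => /andP[-> ]; rewrite le_eqVlt => /predU1P[->|->].
  by right.
by left.
Qed.

(* The value of X^* at the right endpoint of the cell, truncated at m: this makes the
   approximation lie below X^* and increase with m. *)
Definition approx_coef X N (m j : nat) : R :=
  fine (mine (rearr X (j.+1%:R / (N * 2 ^ m)%:R)) m%:R%:E).

Definition step_approx X N m : R -> \bar R := step (N * 2 ^ m) (approx_coef X N m).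

Lemma approx_coefE X N m j : (approx_coef X N m j)%:E =
  mine (rearr X (j.+1%:R / (N * 2 ^ m)%:R)) m%:R%:E.
Proof.
rewrite /approx_coef; set a := rearr _ _; have a0 : 0 <= a by exact: rearr_ge0.
rewrite fineK// ge0_fin_numE; last by rewrite le_min a0 lee_fin ler0n.
by rewrite gt_min ltry orbT.
Qed.

Lemma approx_coef_ge0 X N m j : (0 <= approx_coef X N m j)%R.
Proof. by rewrite -lee_fin approx_coefE le_min rearr_ge0 lee_fin ler0n. Qed.

Lemma approx_coef_nonincreasing X N m i j : (i <= j)%N ->
  (approx_coef X N m j <= approx_coef X N m i)%R.
Proof.
move=> ij; rewrite -lee_fin !approx_coefE le_min !ge_min lexx orbT andbT.
by rewrite rearr_nonincreasing// ler_wpM2r ?invr_ge0// ler_nat.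
Qed.

Lemma N2_gt0 N m : (0 < N)%N -> (0 < N * 2 ^ m)%N.
Proof. by move=> N0; rewrite muln_gt0 N0 expn_gt0. Qed.

Lemma approx_le_rearr X N m (w : R) : (0 < N)%N -> step_approx X N m w <= rearr X w.
Proof.
move=> N0; have M0 := N2_gt0 m N0; rewrite /step_approx.
apply: (@step_ind R (N * 2 ^ m) _ (fun w v => v <= rearr X w) M0).
  by move=> *; exact: rearr_ge0.
move=> i u iN u01; rewrite /cell/= in_itv/= => /andP[_ /ltW ui].
by rewrite approx_coefE ge_min rearr_nonincreasing.
Qed.

Lemma approx_nondecreasing X N (w : R) m m' : (0 < N)%N -> (m <= m')%N ->
  step_approx X N m w <= step_approx X N m' w.
Proof.
move=> N0 mm'; rewrite /step_approx /step; case: ifP => // w01.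
have M0 := N2_gt0 m N0; have M'0 := N2_gt0 m' N0.
rewrite !approx_coefE le_min !ge_min lee_fin ler_nat mm' orbT andbT.
apply/orP; left; apply: rearr_nonincreasing.
have /andP[_] : (0%:R <= ((N * 2 ^ m)%:R * w) < (Num.truncn ((N * 2 ^ m)%:R * w)).+1%:R)%R.
  by rewrite mulr_ge0 ?(andP w01).1//= truncnS_gt.
set i := Num.truncn _ => hi.
have w'0 : (0 <= (N * 2 ^ m')%:R * w)%R by rewrite mulr_ge0 ?(andP w01).1.
have := truncn_itv w'0; set i' := Num.truncn _ => /andP[hi' _].
(* Each coarse cell splits into 2^(m'-m) fine ones. As i' is an integer, i' < 2^(m'-m) (i+1) means
   that the right endpoint of the fine cell does not pass that of the coarse one. *)
have E : (N * 2 ^ m' = 2 ^ (m' - m) * (N * 2 ^ m))%N.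
  by rewrite mulnCA -expnD subnK.
have : (i'%:R < (2 ^ (m' - m) * i.+1)%:R :> R)%R.
  apply: le_lt_trans hi' _; rewrite E [(2 ^ _ * (N * _))%:R%R]natrM -mulrA [(2 ^ _ * _.+1)%:R%R]natrM.
  by rewrite ltr_pM2l// ltr0n expn_gt0.
rewrite ltr_nat => ii'.
rewrite ler_pdivrMr ?ltr0n// mulrAC ler_pdivlMr ?ltr0n//.
by rewrite -!natrM ler_nat E [leqRHS]mulnA (mulnC i.+1 (2 ^ _)%N) leq_mul2r ii' orbT.
Qed.

Lemma approx_cvg X N (w : R) : Mplus X -> (0 < N)%N -> Omega w ->
  step_approx X N m w @[m --> \oo] --> rearr X w.
Proof.
move=> MX N0 wO.
have nd : nondecreasing_seq (fun m => step_approx X N m w).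
  by move=> m m'; exact: approx_nondecreasing.
have := ereal_nondecreasing_cvgn nd.
suff -> : ereal_sup (range (fun m => step_approx X N m w)) = rearr X w by [].
apply/eqP; rewrite eq_le; apply/andP; split.
  by apply: ge_ereal_sup => _ [m _ <-]; exact: approx_le_rearr.
have [w01|->] := Omega_split wO; last first.
  rewrite rearr_ge1//; apply: le_trans (ereal_sup_ubound _); last by exists 0%N.
  by apply: step_ge0 => [|i]; [exact: N2_gt0|exact: approx_coef_ge0].
apply: le_ereal_nneg_ub => [|l l0 Sl].
  apply: le_trans (ereal_sup_ubound _); last by exists 0%N.
  by apply: step_ge0 => [|i]; [exact: N2_gt0|exact: approx_coef_ge0].
rewrite rearr_le// leNgt; apply/negP => wd.
have dE := dist_fin l MX; set d := fine _ in dE.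
rewrite dE lte_fin -subr_gt0 in wd.
(* Here m exceeds l, so truncation at m stays above l; it also exceeds 1/(d - w), so, as 2^m >= m, a
   cell of length 1/(N 2^m) containing w ends before d. *)
pose m := (Num.truncn (Num.max l (d - w)^-1)%R).+1.
have : step_approx X N m w <= l%:E.
  by apply: le_trans Sl; apply: ereal_sup_ubound; exists m.
have [wi iM] := cell_truncn (N2_gt0 m N0) w01; set i := Num.truncn _ in wi iM.
rewrite /step_approx (cell_stepE iM wi) approx_coefE leNgt => /negP; apply.
have : (Num.max l (d - w)^-1 < m%:R)%R by exact: truncnS_gt.
rewrite gt_max => /andP[lm dm].
rewrite lt_min lte_fin lm andbT rearr_gt// dE lte_fin.
have M0 : (0 < (N * 2 ^ m)%:R :> R)%R by rewrite ltr0n N2_gt0.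
have /(cellE _ _ (N2_gt0 m N0))/andP[iw _] := wi.
rewrite -[i.+1]addn1 natrD ltr_pdivrMr//.
apply: (@le_lt_trans _ _ ((N * 2 ^ m)%:R * w + 1)%R); first by rewrite lerD2r.
rewrite -ltrBrDl (mulrC _ w) -mulrBl -ltr_pdivrMl// mulr1; apply: lt_le_trans dm _.
by rewrite ler_nat (leq_trans (ltnW (ltn_expl m (ltnSn 1))))// leq_pmull.
Qed.

(** By [rearr_le] it suffices to count coefficients: for decreasing y, at most j of them exceed l if
    y j <= l, and at least j + 1 otherwise. *)
Lemma rearr_step N y (w : R) : (0 < N)%N -> (forall i, 0 <= y i)%R ->
  (forall i j, (i <= j < N)%N -> y j <= y i)%R -> Omega w ->
  rearr (step N y) w = step N y w.
Proof.
move=> N0 y0 yd wO; have MY := step_Mplus N0 y0.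
have [w01|->] := Omega_split wO; last first.
  by rewrite rearr_ge1// /step ltxx andbF.
have [wj jN] := cell_truncn N0 w01; set j := Num.truncn _ in wj jN.
apply: eq_ereal_nneg_ub; [exact: rearr_ge0|exact: step_ge0|] => l l0.
rewrite rearr_le// mu_step_gt// (cell_stepE jN wj) !lee_fin.
have NR : (0 < N%:R :> R)%R by rewrite ltr0n.
have /(cellE _ _ N0)/andP[jw wj1] := wj.
rewrite -natr_sum ler_pdivrMr// (mulrC w).
have [yl|ly] := leP (y j) l.
  apply: le_trans jw; rewrite ler_nat.
  rewrite -[leqRHS](sum_ltn_ord (ltnW jN)); apply: leq_sum => i _.
  case: (ltnP i j) => ij; first by case: (_ < _)%R.
  by rewrite ltNge (le_trans (yd _ _ _) yl)// ij/=.
apply/negbTE; rewrite -ltNge; apply: lt_le_trans wj1 _; rewrite ler_nat.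
rewrite -[leqLHS](sum_ltn_ord jN); apply: leq_sum => i _.
case: (ltnP i j.+1) => // ij.
by rewrite (lt_le_trans ly)// yd// jN andbT.
Qed.

Lemma rearrM X (a w : R) : Mplus X -> (0 < a)%R ->
  rearr (fun u => a%:E * X u) w = a%:E * rearr X w.
Proof.
move=> MX a0; have MaX : Mplus (fun u => a%:E * X u).
  split; first by apply: measurable_funeM; exact: MX.1.
  by move=> u uO; apply: mule_ge0; [rewrite lee_fin ltW|exact: MX.2].
have aW : (0 <= a)%R by exact: ltW.
apply: eq_ereal_nneg_ub => [||l l0]; first exact: rearr_ge0.
  by apply: mule_ge0; [rewrite lee_fin|exact: rearr_ge0].
rewrite rearr_le// muleC -lee_pdivlMr// -EFinM rearr_le ?divr_ge0//.
congr (mu _ <= _); apply/seteqP; split=> u [uO]; rewrite /= !gee0_abs ?MX.2 ?MaX.2//;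
  by rewrite EFinM lte_pdivrMr// muleC.
Qed.

Lemma MplusD X (c : R) : Mplus X -> (0 <= c)%R -> Mplus (fun u => X u + c%:E).
Proof.
move=> MX c0; split; first by apply: emeasurable_funD; [exact: MX.1|exact: measurable_cst].
by move=> u uO; apply: adde_ge0; [exact: MX.2|rewrite lee_fin].
Qed.

(** For l >= c the level set of X + c above l is that of X above l - c; for l < c it is all of
    [Omega], of measure 1 > w. The restriction w < 1 matters: at w = 1 every rearrangement
    vanishes. *)
Lemma rearrD X (c w : R) : Mplus X -> (0 <= c)%R -> (0 <= w < 1)%R ->
  rearr (fun u => X u + c%:E) w = rearr X w + c%:E.
Proof.
move=> MX c0 w01; have MXc := MplusD MX c0.
apply: eq_ereal_nneg_ub => [||l l0]; first exact: rearr_ge0.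
  by apply: adde_ge0; [exact: rearr_ge0|rewrite lee_fin].
rewrite rearr_le// -leeBrDr// -EFinB.
have [cl|lc] := leP c l.
  rewrite rearr_le ?subr_ge0//; congr (mu _ <= _).
  apply/seteqP; split=> u [uO]; rewrite /= !gee0_abs ?MX.2 ?MXc.2//;
    by rewrite EFinB lteBlDr.
rewrite (_ : [set u | _] = Omega).
  rewrite mu_Omega; apply/idP/idP => h.
    by case/andP: w01 => _; rewrite ltNge -lee_fin h.
  have := le_trans (rearr_ge0 X w) h.
  by rewrite lee_fin subr_ge0 leNgt lc.
apply/seteqP; split=> u // => [[]//|uO]; split=> //.
rewrite gee0_abs ?MXc.2//; apply: (@lt_le_trans _ _ c%:E); first by rewrite lte_fin.
by rewrite leeDr// MX.2.
Qed.

End approximation.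

(** * Operations on step functions and refinement of partitions *)

Lemma sum_blocks {V : nmodType} (N M : nat) (F : nat -> V) :
  (\sum_(i < N * M) F i = \sum_(j < N) \sum_(k < M) F (j * M + k)%N)%R.
Proof.
elim: N => [|N IH]; first by rewrite !big_ord0.
by rewrite mulSnr big_split_ord/= IH big_ord_recr.
Qed.

Section step_algebra.
Context {R : realType}.
Implicit Types (x y z : nat -> R) (N M : nat).

Lemma stepD N x y w : step N (fun i => x i + y i)%R w = step N x w + step N y w.
Proof. by rewrite /step; case: ifP; rewrite ?adde0. Qed.

Lemma stepM N x y w : step N (fun i => x i * y i)%R w = step N x w * step N y w.
Proof. by rewrite /step; case: ifP; rewrite ?mule0. Qed.

Lemma stepZ N (a : R) x w : step N (fun i => a * x i)%R w = a%:E * step N x w.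
Proof. by rewrite /step; case: ifP; rewrite ?mule0. Qed.

Lemma step_refine N M x w : (0 < N)%N -> (0 < M)%N ->
  step N x w = step (N * M) (fun i => x (i %/ M)%N) w.
Proof.
move=> N0 M0; have NM0 : (0 < N * M)%N by rewrite muln_gt0 N0.
apply: (@step_ind R _ _ (fun w v => step N x w = v) NM0) => {w} [w|i w iNM w01].
  by move=> /negP w01; rewrite /step ifN.
move=> /(cellE _ _ NM0)/andP[iw wi].
have MR : (0 < M%:R :> R)%R by rewrite ltr0n.
apply: cell_stepE; first by rewrite ltn_divLR.
apply/(cellE _ _ N0); rewrite -(ler_pM2r MR) -[X in _ && X](ltr_pM2r MR).
rewrite mulrAC -!natrM; apply/andP; split.
  by apply: le_trans iw; rewrite ler_nat leq_trunc_div.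
by apply: lt_le_trans wi _; rewrite ler_nat ltn_ceil.
Qed.

End step_algebra.

(** * Rearrangement-invariant norms of step functions *)

Section norm.
Context {R : realType} (rho : (R -> \bar R) -> \bar R) (ri : ri_function_norm rho).
Local Notation mu := (@mu R).
Local Notation Omega := (@Omega R).
Implicit Types (X Y Z : R -> \bar R) (x y z : nat -> R) (N M : nat).

Lemma norm_ge0 X : Mplus X -> 0 <= rho X.
Proof. by case: ri => -[h _] _; exact: h. Qed.

Lemma normZ X (a : R) : Mplus X -> (0 <= a)%R ->
  rho (fun w => a%:E * X w) = a%:E * rho X.
Proof. by case: ri => -[_ [_ [h _]]] _; exact: h. Qed.

Lemma normD X Y : Mplus X -> Mplus Y -> rho (fun w => X w + Y w) <= rho X + rho Y.
Proof. by case: ri => -[_ [_ [_ [h _]]]] _; exact: h. Qed.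

(** The endpoint 1 is a null set, so comparison on [0,1[ is comparison almost everywhere on
    [Omega]. *)
Lemma norm_le X Y : Mplus X -> Mplus Y ->
  (forall w, (0 <= w < 1)%R -> X w <= Y w) -> rho X <= rho Y.
Proof.
move=> MX MY XY; case: ri => -[_ [_ [_ [_ [h _]]]]] _; apply: h => //.
exists [set 1%R]; split; [exact: measurable_set1|exact: lebesgue_measure_set1|].
move=> w /=; apply: contra_notP => /eqP w1 /Omega_split[w01|/eqP]; first exact: XY.
by rewrite (negbTE w1).
Qed.

Lemma norm_eq X Y : Mplus X -> Mplus Y ->
  (forall w, (0 <= w < 1)%R -> X w = Y w) -> rho X = rho Y.
Proof.
by move=> MX MY XY; apply/le_anti/andP; split; apply: norm_le => // w /XY ->.
Qed.

Lemma norm_equimeasurable X Y : Mplus X -> Mplus Y -> equimeasurable X Y -> rho X = rho Y.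
Proof. by case: ri => _; exact. Qed.

Lemma Mplus_cst (c : R) : (0 <= c)%R -> Mplus (fun=> c%:E).
Proof. by move=> c0; split=> [|w _]; [exact: measurable_cst|rewrite lee_fin]. Qed.

Lemma norm_cst (c : R) : (0 <= c)%R -> rho (fun=> c%:E) = c%:E.
Proof.
move=> c0; have M1 := Mplus_cst (@ler01 R).
have [_ [_ [_ [_ [_ [_ [_ h1]]]]]]] := ri.1.
transitivity (c%:E * rho (fun=> 1%:E)).
  by rewrite -normZ//; congr rho; apply/funext => w; rewrite mule1.
suff -> : rho (fun=> 1%:E) = 1 by rewrite mule1.
rewrite -[RHS]h1; apply: norm_eq => //.
  split=> [|w _]; last by rewrite /chi lee_fin indicE ler0n.
  by apply/measurable_EFinP; apply: measurable_indic; exact: measurable_Omega.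
move=> w /andP[w0 w1]; rewrite /chi indicE mem_set//.
by rewrite /Defs.Omega/= in_itv/= w0 ltW.
Qed.

Lemma norm_step_cst N (c : R) : (0 < N)%N -> (0 <= c)%R -> rho (step N (fun=> c)) = c%:E.
Proof.
move=> N0 c0; rewrite -[RHS]norm_cst//; apply: norm_eq; [exact: step_Mplus|exact: Mplus_cst|].
by move=> w w01; rewrite /step w01.
Qed.

(** Real-valued, as the finite-dimensional Hahn-Banach theorem demands; by [step_normE], [fine]
    loses nothing for nonnegative coefficients. *)
Definition step_norm N x : R := fine (rho (step N x)).

Lemma step_norm_cst N (c : R) : (0 < N)%N -> (0 <= c)%R -> step_norm N (fun=> c) = c.
Proof. by move=> N0 c0; rewrite /step_norm norm_step_cst. Qed.

Lemma step_normE N x : (0 < N)%N -> (forall i, 0 <= x i)%R ->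
  rho (step N x) = (step_norm N x)%:E.
Proof.
move=> N0 x0; rewrite /step_norm fineK// ge0_fin_numE; last first.
  by apply: norm_ge0; exact: step_Mplus.
(* Finiteness comes from domination by the constant equal to the sum of the coefficients, whose norm
   is that constant. *)
have C0 : (0 <= \sum_(i < N) x i)%R by rewrite sumr_ge0.
apply: (@le_lt_trans _ _ (\sum_(i < N) x i)%R%:E); last exact: ltry.
rewrite -(norm_step_cst N0 C0); apply: norm_le; [exact: step_Mplus|exact: step_Mplus|].
move=> w w01; have [wi iN] := cell_truncn N0 w01.
rewrite /step w01 lee_fin (bigD1 (Ordinal iN))//= lerDl.
by rewrite sumr_ge0.
Qed.

Lemma step_norm_le N x y : (0 < N)%N -> (forall i, 0 <= x i)%R -> (forall i, 0 <= y i)%R ->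
  (forall i, (i < N)%N -> x i <= y i)%R -> (step_norm N x <= step_norm N y)%R.
Proof.
move=> N0 x0 y0 xy; rewrite -lee_fin -!step_normE//.
apply: norm_le; [exact: step_Mplus|exact: step_Mplus|] => w w01.
have [wi iN] := cell_truncn N0 w01.
by rewrite !(cell_stepE iN wi) lee_fin xy.
Qed.

Lemma step_norm_eq N x y : (0 < N)%N -> (forall i, 0 <= x i)%R -> (forall i, 0 <= y i)%R ->
  (forall i, (i < N)%N -> x i = y i)%R -> step_norm N x = step_norm N y.
Proof.
by move=> N0 x0 y0 xy; apply/le_anti/andP; split; apply: step_norm_le => // i /xy ->.
Qed.

Lemma step_normD N x y : (0 < N)%N -> (forall i, 0 <= x i)%R -> (forall i, 0 <= y i)%R ->
  (step_norm N (fun i => x i + y i) <= step_norm N x + step_norm N y)%R.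
Proof.
move=> N0 x0 y0; rewrite -lee_fin EFinD -!step_normE//; last by move=> i; rewrite addr_ge0.
rewrite (funext (stepD N x y)); apply: normD; exact: step_Mplus.
Qed.

Lemma step_normZ N (a : R) x : (0 < N)%N -> (0 <= a)%R -> (forall i, 0 <= x i)%R ->
  step_norm N (fun i => a * x i)%R = (a * step_norm N x)%R.
Proof.
move=> N0 a0 x0; apply: EFin_inj; rewrite EFinM -!step_normE//; last first.
  by move=> i; rewrite mulr_ge0.
by rewrite (funext (stepZ N a x)) normZ//; exact: step_Mplus.
Qed.

(** Permuting the cells keeps the distribution function, hence the norm. *)
Lemma step_norm_reindex N x (s : nat -> nat) : (0 < N)%N -> (forall i, 0 <= x i)%R ->
  (forall i, (i < N)%N -> (s i < N)%N) ->
  {in [pred i | (i < N)%N] &, injective s} ->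
  step_norm N (fun i => x (s i)) = step_norm N x.
Proof.
move=> N0 x0 sN sinj; congr fine; apply: norm_equimeasurable; [exact: step_Mplus..|].
move=> l l0; rewrite !mu_step_gt//; congr (_ / _)%:E.
exact: (sum_reindex_nat (fun i => (l < x i)%R%:R)).
Qed.

Lemma step_norm_sum N M (f : nat -> nat -> R) : (0 < N)%N -> (forall k i, 0 <= f k i)%R ->
  (step_norm N (fun i => \sum_(k < M) f k i) <= \sum_(k < M) step_norm N (f k))%R.
Proof.
move=> N0 f0; elim: M => [|M IH].
  rewrite big_ord0 (_ : (fun i => _) = (fun=> 0%R)).
    by rewrite step_norm_cst.
  by apply/funext => i; rewrite big_ord0.
rewrite big_ord_recr/= (_ : (fun i => _) = (fun i => \sum_(k < M) f k i + f M i)%R).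
  apply: le_trans (step_normD _ _ _) _ => //; last by rewrite lerD2r.
  by move=> i; rewrite sumr_ge0.
by apply/funext => i; rewrite big_ord_recr.
Qed.

Definition block_mean M z (j : nat) : R := ((\sum_(k < M) z (j * M + k)%N) / M%:R)%R.

Lemma block_mean_ge0 M z j : (forall i, 0 <= z i)%R -> (0 <= block_mean M z j)%R.
Proof. by move=> z0; rewrite divr_ge0// sumr_ge0. Qed.

(* The block means are the average over k < M of the cyclic shifts by k inside each
   block, and each of these shifts permutes the cells. *)
Lemma step_norm_block_mean N M z : (0 < N)%N -> (0 < M)%N -> (forall i, 0 <= z i)%R ->
  (step_norm N (block_mean M z) <= step_norm (N * M) z)%R.
Proof.
move=> N0 M0 z0; have NM0 : (0 < N * M)%N by rewrite muln_gt0 N0.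
pose s k i := (i %/ M * M + (i %% M + k) %% M)%N.
have sdiv k i : (s k i %/ M = i %/ M)%N.
  by rewrite /s divnMDl// [X in (_ + X)%N]divn_small ?addn0// ltn_pmod.
have smod k i : (s k i %% M = (i %% M + k) %% M)%N.
  by rewrite /s modnMDl modn_mod.
have addk_inj k i j : ((i %% M + k) %% M = (j %% M + k) %% M -> i %% M = j %% M)%N.
  by move=> /eqP; rewrite eqn_modDr !modn_mod => /eqP.
have meanE i : block_mean M z (i %/ M) = (M%:R^-1 * \sum_(k < M) z (s k i))%R.
  rewrite /block_mean mulrC; congr (_ * _)%R; apply/esym.
  rewrite -(sum_reindex_nat (fun k => z (i %/ M * M + k)%N) (s := fun k => (i %% M + k) %% M)%N)//.
    by move=> k _; rewrite ltn_mod.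
  move=> k k'; rewrite !inE => kM k'M /eqP; rewrite eqn_modDl !modn_small//.
  by move=> /eqP.
(* The means are rewritten on the fine partition, where the shifts of z live. *)
have -> : step_norm N (block_mean M z) =
    step_norm (N * M) (fun i => block_mean M z (i %/ M)).
  by congr (fine (rho _)); apply/funext => w; exact: step_refine.
have MR : (0 < M%:R :> R)%R by rewrite ltr0n.
rewrite (funext meanE) step_normZ ?invr_ge0// => [|i]; last by rewrite sumr_ge0.
rewrite mulrC ler_pdivrMr//.
apply: le_trans (@step_norm_sum (N * M) M (fun k i => z (s k i)) NM0 _) _ => //.
rewrite (eq_bigr (fun=> step_norm (N * M) z)).
  by rewrite sumr_const card_ord mulr_natr.
move=> k _; apply: (@step_norm_reindex _ z (s k)) => //.
  move=> i iNM; rewrite -ltn_divLR// sdiv ltn_divLR//.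
move=> i j _ _ E; rewrite (divn_eq i M) (divn_eq j M) -(sdiv k i) -(sdiv k j) E.
by congr (_ + _)%N; apply: (addk_inj k); rewrite -!smod E.
Qed.

End norm.

(** Two upper bounds whose sum is attained are both attained; used for the pairings of y with x and
    with 1. *)
Lemma eq_of_leD {R : realDomainType} (a b c d : R) :
  (a <= c -> b <= d -> c + d <= a + b -> a = c /\ b = d)%R.
Proof. by move=> *; split; lra. Qed.

(** * Integrals of rearrangements *)

Section duality.
Context {R : realType}.
Local Notation mu := (@mu R).
Local Notation Omega := (@Omega R).
Implicit Types (X Y Z : R -> \bar R) (x y z : nat -> R) (N M : nat).

Lemma measurable_approx X N m (D : set R) : (0 < N)%N -> measurable_fun D (step_approx X N m).
Proof. by move=> N0; apply: measurable_step; exact: N2_gt0. Qed.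

Lemma Mplus_approx X N m : (0 < N)%N -> Mplus (step_approx X N m).
Proof. by move=> N0; apply: step_Mplus; [exact: N2_gt0|exact: approx_coef_ge0]. Qed.

(** Measurability comes from the pointwise convergence of the step approximations. *)
Lemma Mplus_rearr X : Mplus X -> Mplus (rearr X).
Proof.
move=> MX; split; last by move=> w _; exact: rearr_ge0.
apply: (@emeasurable_fun_cvg _ _ _ _ (fun m => step_approx X 1 m)) => [m|w wO].
  exact: measurable_approx.
exact: approx_cvg.
Qed.

Lemma pairingC X Y : pairing X Y = pairing Y X.
Proof. by apply: eq_integral => w _; rewrite muleC. Qed.

(** On the dyadic refinement the integrand is a step function; y is constant on each block of 2^m
    cells, so only the block means of the other factor remain. *)
Lemma integral_step_approx N m y Z : (0 < N)%N -> (forall i, 0 <= y i)%R ->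
  \int[mu]_(w in Omega) (step N y w * step_approx Z N m w) =
  ((\sum_(j < N) y j * block_mean (2 ^ m) (approx_coef Z N m) j) / N%:R)%:E.
Proof.
move=> N0 y0; have M0 : (0 < 2 ^ m)%N by rewrite expn_gt0.
set M := (2 ^ m)%N in M0 *; set z := approx_coef Z N m.
transitivity (\int[mu]_(w in Omega) step (N * M) (fun i => y (i %/ M)%N * z i)%R w).
  by apply: eq_integral => w _; rewrite stepM -step_refine.
rewrite integral_step ?muln_gt0 ?N0// => [|i]; last first.
  by rewrite mulr_ge0//; exact: approx_coef_ge0.
rewrite (sum_blocks N M (fun i => y (i %/ M)%N * z i)%R).
rewrite (eq_bigr (fun j : 'I_N => (y j * block_mean M z j) * M%:R)%R) => [|j _].
  by rewrite -mulr_suml natrM invfM mulrACA mulfV ?mulr1// pnatr_eq0 gtn_eqF.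
rewrite /block_mean -mulrA divfK ?pnatr_eq0 ?gtn_eqF// mulr_sumr.
by apply: eq_bigr => k _; rewrite divnMDl// divn_small ?addn0.
Qed.

Lemma mule_indic_gt (e : R) Y i w : Mplus Y -> Omega w ->
  e%:E * (\1_[set u | Omega u /\ ((e * i.+1%:R)%:E < `|Y u|)%E] w)%:E =
  (if (e * i.+1%:R)%:E < Y w then e%:E else 0).
Proof.
move=> MY wO; rewrite indicE (_ : (w \in _) = ((e * i.+1%:R)%:E < Y w)).
  by case: ifP; rewrite ?mule1 ?mule0.
by apply/idP/idP => [|h]; rewrite inE /= gee0_abs ?MY.2// => -[].
Qed.

(* The series is e times the number of i >= 1 with e * i < b. *)
Lemma nneseries_levels_le (e : R) (b : \bar R) : (0 < e)%R -> 0 <= b ->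
  \sum_(0 <= i <oo) (if (e * i.+1%:R)%:E < b then e%:E else 0) <= b.
Proof.
move=> e0 b0; apply: lime_le.
  by apply: is_cvg_nneseries => i _ _; case: ifP; rewrite // lee_fin ltW.
(* The minimum with e n carries the induction: when term n is counted, the new sum is at most e (n +
   1), which is below b. *)
apply: nearW => n; suff : \sum_(0 <= i < n) (if (e * i.+1%:R)%:E < b then e%:E else 0)
    <= mine (e * n%:R)%:E b by rewrite le_min => /andP[].
elim: n => [|n IH]; first by rewrite big_geq// le_min lee_fin mulr0 lexx.
rewrite big_nat_recr//= le_min; move: IH; rewrite le_min => /andP[IH1 IH2].
have H : \sum_(0 <= i < n) (if (e * i.+1%:R)%:E < b then e%:E else 0) + e%:E <=
    (e * n.+1%:R)%:E.
  by rewrite -[n.+1]addn1 natrD mulrDr mulr1 EFinD leeD2r.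
case: ifP => hb; first by rewrite H (le_trans H)// ltW.
rewrite adde0 IH2 andbT (le_trans IH1)// lee_fin ler_pM2l// ler_nat//.
Qed.

(** If b > e + S, then S is finite, and n = floor(S/e) + 1 satisfies S < e n <= S + e < b. The first
    n terms then all equal e, so S >= e n, a contradiction. *)
Lemma le_nneseries_levels (e : R) (b : \bar R) : (0 < e)%R -> 0 <= b ->
  b <= e%:E + \sum_(0 <= i <oo) (if (e * i.+1%:R)%:E < b then e%:E else 0).
Proof.
move=> e0 b0; set S := \sum_(0 <= i <oo) _.
have S_ge n : (e * n%:R)%:E < b -> (e * n%:R)%:E <= S.
  move=> nb; apply: (@le_trans _ _
      (\sum_(0 <= i < n) (if (e * i.+1%:R)%:E < b then e%:E else 0))); last first.
    by apply: nneseries_lim_ge => i _ _; case: ifP; rewrite // lee_fin ltW.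
  rewrite (eq_big_nat _ _ (F2 := fun=> e%:E)) => [|i /andP[_ iN]]; last first.
    by rewrite ifT// (le_lt_trans _ nb)// lee_fin ler_pM2l// ler_nat.
  by rewrite big_mkord sumEFin sumr_const card_ord mulr_natr.
have S0 : 0 <= S by apply: nneseries_ge0 => i _ _; case: ifP; rewrite // lee_fin ltW.
rewrite leNgt; apply/negP => h.
have Sfin : S \is a fin_num.
  rewrite ge0_fin_numE//; apply: lt_le_trans (leey b).
  by apply: le_lt_trans h; rewrite leeDr// lee_fin ltW.
have SE : S = (fine S)%:E by rewrite fineK.
have := S_ge (Num.truncn (fine S / e)).+1.
rewrite SE in h S0 *; rewrite lee_fin in S0.
have /andP[h1 h2] := truncn_itv (divr_ge0 S0 (ltW e0)).
rewrite ler_pdivlMr// in h1; rewrite ltr_pdivrMr// in h2.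
rewrite lee_fin leNgt mulrC h2 => /(_ _)/negP; apply=> //.
apply: le_lt_trans h; rewrite -EFinD lee_fin -[_.+1]addn1 natrD mulrDl mul1r addrC.
by rewrite lerD2l.
Qed.

(** A discrete layer-cake argument: the sum [L] of levels of height e approximates its function from
    below within e, and its integral depends only on the distribution function, which Y and Y^*
    share. *)
Lemma le_integral_rearr Y : Mplus Y ->
  \int[mu]_(w in Omega) Y w <= \int[mu]_(w in Omega) rearr Y w.
Proof.
move=> MY; apply/lee_addgt0Pr => e e0; have MY' := Mplus_rearr MY.
pose L Z i w := e%:E * (\1_[set u : R | Omega u /\ ((e * i.+1%:R)%:E < `|Z u|)%E] w)%:E : \bar R.
have L0 Z i w : Omega w -> 0 <= L Z i w.
  by move=> _; rewrite /L -EFinM lee_fin mulr_ge0// ?indicE// ltW.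
have mL Z i : Mplus Z -> measurable_fun Omega (L Z i).
  move=> MZ; apply: measurable_funeM; apply/measurable_EFinP.
  by apply: measurable_indic; exact: measurable_gt.
have mSL Z : Mplus Z -> measurable_fun Omega (fun w => \sum_(0 <= i <oo) L Z i w).
  move=> MZ; exact: (@ge0_emeasurable_sum _ _ _ Omega (L Z) xpredT
    (fun i w wO _ => L0 Z i w wO) (fun i _ => mL Z i MZ)).
have LE Z w : Mplus Z -> Omega w -> \sum_(0 <= i <oo) L Z i w =
    \sum_(0 <= i <oo) (if (e * i.+1%:R)%:E < Z w then e%:E else 0).
  by move=> MZ wO; apply: eq_eseriesr => i _; exact: mule_indic_gt.
have intL Z : Mplus Z -> \int[mu]_(w in Omega) (\sum_(0 <= i <oo) L Z i w) =
    \sum_(0 <= i <oo) e%:E * mu [set u | Omega u /\ (e * i.+1%:R)%:E < `|Z u|].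
  move=> MZ; rewrite integral_nneseries//; first last.
  - by move=> i w; exact: L0.
  - by move=> i; exact: mL.
  - exact: measurable_Omega.
  apply: eq_eseriesr => i _; rewrite ge0_integralZl_EFin//; first last.
  - exact: ltW.
  - by apply/measurable_EFinP; apply: measurable_indic; exact: measurable_gt.
  - exact: measurable_Omega.
  rewrite integral_indic//; [|exact: measurable_Omega|exact: measurable_gt].
  by rewrite setIidl// => u [].
have intLE : \int[mu]_(w in Omega) (\sum_(0 <= i <oo) L Y i w) =
    \int[mu]_(w in Omega) (\sum_(0 <= i <oo) L (rearr Y) i w).
  rewrite !intL//; apply: eq_eseriesr => i _.
  by rewrite (equimeasurable_rearr MY)// mulr_ge0// ltW.
apply: (@le_trans _ _ (\int[mu]_(w in Omega) (e%:E + \sum_(0 <= i <oo) L Y i w))).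
  apply: ge0_le_integral => //.
  - exact: measurable_Omega.
  - exact: MY.2.
  - exact: MY.1.
  - by apply: emeasurable_funD; [exact: measurable_cst|exact: mSL].
  by move=> w wO; rewrite LE//; apply: le_nneseries_levels => //; exact: MY.2.
rewrite ge0_integralD//; first last.
- exact: mSL.
- by move=> w wO; apply: nneseries_ge0 => i _ _; exact: L0.
- by move=> w _; rewrite lee_fin ltW.
- exact: measurable_Omega.
rewrite integral_cst; last exact: measurable_Omega.
rewrite -[X in e%:E * X]/(mu Omega) mu_Omega mule1 addeC intLE leeD2r//.
apply: ge0_le_integral => //.
- exact: measurable_Omega.
- by move=> w wO; apply: nneseries_ge0 => i _ _; exact: L0.
- exact: mSL.
- exact: MY'.1.
by move=> w wO; rewrite LE//; apply: nneseries_levels_le => //; exact: rearr_ge0.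
Qed.

End duality.

(** * Duality *)

Section associate.
Context {R : realType} (rho : (R -> \bar R) -> \bar R) (ri : ri_function_norm rho).
Local Notation mu := (@mu R).
Local Notation Omega := (@Omega R).
Local Notation step_norm := (step_norm rho).
Implicit Types (X Y Z : R -> \bar R) (x y z : nat -> R) (N M : nat).

Lemma norm_rearr X : Mplus X -> rho (rearr X) = rho X.
Proof.
move=> MX; apply/esym/(norm_equimeasurable ri) => //; first exact: Mplus_rearr.
exact: equimeasurable_rearr.
Qed.

(** The Fatou property is applied to X^*, which has the norm of X. *)
Lemma norm_approx_cvg X N : Mplus X -> (0 < N)%N ->
  rho (step_approx X N m) @[m --> \oo] --> rho X.
Proof.
move=> MX N0; rewrite -(norm_rearr MX).
have [_ [_ [_ [_ [_ [h _]]]]]] := ri.1; apply: h => //.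
- by move=> m; exact: Mplus_approx.
- exact: Mplus_rearr.
apply: aeW => w wO; split; last exact: approx_cvg.
by move=> m m'; exact: approx_nondecreasing.
Qed.

Lemma norm_approx_le X N m : Mplus X -> (0 < N)%N -> rho (step_approx X N m) <= rho X.
Proof.
move=> MX N0; rewrite -(norm_rearr MX).
apply: (norm_le ri); [exact: Mplus_approx|exact: Mplus_rearr|].
by move=> w _; exact: approx_le_rearr.
Qed.

Lemma pairing_le_norm X Y : Mplus X -> Mplus Y -> assoc_norm rho Y <= 1 -> pairing X Y <= rho X.
Proof.
move=> MX MY Y1; have rX0 := norm_ge0 ri MX.
case rX : (rho X) rX0 => [r| |]; [|by move=> _; rewrite leey|by rewrite leeNy_eq].
rewrite lee_fin => r0; apply/lee_addgt0Pr => e e0.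
(* X is normalised by r + e, since its norm r may be 0. *)
have re : (0 < r + e)%R by rewrite ltr_wpDl.
have a0 : (0 < (r + e)^-1)%R by rewrite invr_gt0.
have MaX : Mplus (fun u => (r + e)^-1%:E * X u).
  split; first by apply: measurable_funeM; exact: MX.1.
  by move=> u uO; apply: mule_ge0; [rewrite lee_fin ltW|exact: MX.2].
have : pairing Y (fun u => (r + e)^-1%:E * X u) <= 1.
  apply: le_trans Y1; apply: ereal_sup_ubound; eexists; [|reflexivity].
  split=> //; rewrite (normZ ri MX (ltW a0)) rX -EFinM lee_fin mulrC ler_pdivrMr// mul1r.
  by rewrite lerDl ltW.
rewrite pairingC /pairing.
under eq_integral do rewrite rearrM// -muleA.
rewrite ge0_integralZl_EFin//; first last.
- exact: ltW.
- apply: emeasurable_funM; exact: (Mplus_rearr _).1.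
- by move=> w _; rewrite mule_ge0 ?rearr_ge0.
- exact: measurable_Omega.
by rewrite muleC lee_pdivrMr// mul1e EFinD.
Qed.

(** Against an arbitrary Z in the unit ball, Z^* is replaced by its dyadic approximations. Their
    pairing with the step function sees only block means on the N cells, where the hypothesis
    applies, and taking block means does not increase the norm. *)
Lemma assoc_norm_step_le1 N y : (0 < N)%N -> (forall i, 0 <= y i)%R ->
  (forall i j, (i <= j < N)%N -> y j <= y i)%R ->
  (forall z, (forall i, 0 <= z i)%R ->
     (\sum_(i < N) y i * z i) / N%:R <= step_norm N z)%R ->
  assoc_norm rho (step N y) <= 1.
Proof.
move=> N0 y0 yd yz; apply: ge_ereal_sup => _ [Z [MZ Z1] <-].
apply: le_trans Z1.
have cvgZ : \int[mu]_(w in Omega) (step N y w * step_approx Z N m w) @[m --> \oo] -->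
    pairing (step N y) Z.
  rewrite (_ : pairing _ _ = \int[mu]_(w in Omega) limn (fun m => step N y w * step_approx Z N m w)).
    apply: cvg_monotone_convergence.
    - exact: measurable_Omega.
    - move=> m; apply: emeasurable_funM; [exact: measurable_step|exact: measurable_approx].
    - move=> m w wO; rewrite mule_ge0//; first exact: step_ge0.
      exact: (Mplus_approx _ _ _).2.
    - move=> w wO m m' mm'; apply: lee_wpmul2l; first exact: step_ge0.
      exact: approx_nondecreasing.
  apply: eq_integral => w; rewrite inE => wO; rewrite rearr_step//.
  apply/esym/cvg_lim => //; rewrite /step; case: ifP => w01.
    apply: cvgeZl => //. exact: approx_cvg.
  under eq_fun do rewrite mul0e.
  by rewrite mul0e; exact: cvg_cst.
apply: (cvge_le _ cvgZ); apply: nearW => m.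
rewrite integral_step_approx//.
have M0 : (0 < 2 ^ m)%N by rewrite expn_gt0.
have z0 := approx_coef_ge0 Z N m.
apply: le_trans (norm_approx_le m MZ N0).
rewrite /step_approx (step_normE ri) ?N2_gt0// lee_fin.
apply: le_trans (step_norm_block_mean ri N0 M0 z0).
by apply: yz => i; exact: block_mean_ge0.
Qed.

(** The constant 1 has norm 1 and serves as test function. *)
Lemma assoc_norm_step_ge N y : (0 < N)%N -> (forall i, 0 <= y i)%R ->
  (forall i j, (i <= j < N)%N -> y j <= y i)%R ->
  ((\sum_(i < N) y i) / N%:R)%:E <= assoc_norm rho (step N y).
Proof.
move=> N0 y0 yd; rewrite -integral_step//.
apply: (@le_trans _ _ (pairing (step N y) (step N (fun=> 1%R)))); last first.
  apply: ereal_sup_ubound; eexists; [|reflexivity]; split; first exact: step_Mplus.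
  by rewrite (norm_step_cst ri).
rewrite /pairing le_eqVlt; apply/orP; left; apply/eqP/eq_integral => w; rewrite inE => wO.
by rewrite !rearr_step// -stepM; congr step; apply/funext => i; rewrite mulr1.
Qed.

Definition swap (i j k : nat) : nat := if k == i then j else if k == j then i else k.

Lemma swapK i j : involutive (swap i j).
Proof.
move=> k; rewrite /swap; case: (eqVneq k i) => [->|ki].
  by rewrite eqxx; case: (eqVneq j i) => [->|].
case: (eqVneq k j) => [->|kj]; first by rewrite eqxx.
by rewrite (negbTE ki) (negbTE kj).
Qed.

Lemma sum_swap N (i j : nat) y x : (i < j < N)%N ->
  (\sum_(k < N) y k * x k - \sum_(k < N) y k * x (swap i j k) =
   (y i - y j) * (x i - x j))%R.
Proof.
move=> /andP[ij jN]; have iN := ltn_trans ij jN.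
rewrite -sumrB (bigD1 (Ordinal iN))//= (bigD1 (Ordinal jN))/=; last first.
  by rewrite -val_eqE/= gtn_eqF.
rewrite big1 ?addr0 => [|k /andP[ki kj]]; last first.
  by rewrite -!val_eqE/= in ki kj; rewrite /swap (negbTE ki) (negbTE kj) subrr.
by rewrite /swap !eqxx gtn_eqF//; lra.
Qed.

(* Exchanging two coordinates of x does not change its norm, so a vector y norming a
   strictly decreasing x is decreasing. *)
Lemma norming_vector N x : (0 < N)%N -> (forall i, 0 <= x i)%R ->
  (forall i j, (i < j < N)%N -> x j < x i)%R ->
  pos_translation_equivariant rho ->
  exists y, [/\ (forall i, 0 <= y i)%R, (forall i j, (i <= j < N)%N -> y j <= y i)%R,
    (\sum_(i < N) y i) / N%:R = 1%R,
    (\sum_(i < N) y i * x i) / N%:R = step_norm N x &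
    (forall z, (forall i, 0 <= z i)%R ->
     (\sum_(i < N) y i * z i) / N%:R <= step_norm N z)]%R.
Proof.
move=> N0 x0 xd eqv; have NR : (0 < N%:R :> R)%R by rewrite ltr0n.
(* Absolute values extend the norm to signed vectors, as Hahn-Banach requires. *)
pose p (u : nat -> R) := step_norm N (fun i => `|u i|)%R.
have abs0 (u : nat -> R) i : (0 <= `|u i|)%R by [].
have [||v vp|q [qp qx]] := @finite_hahn_banach R N p (fun i => x i + 1)%R.
- move=> u v; apply: le_trans (step_normD ri N0 (abs0 u) (abs0 v)).
  by apply: (step_norm_le ri) => // i *; rewrite ?addr_ge0// ler_normD.
- move=> a u a0; rewrite /p -(step_normZ ri N0 a0 (abs0 u)).
  by congr (step_norm _ _); apply/funext => i; rewrite normrM ger0_norm.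
- by move=> h; apply: (step_norm_eq ri) => // i /h ->.
(* The factor N cancels the cell length 1/N; absolute values make the coefficients nonnegative. *)
pose y i := (`|q i| * N%:R)%R.
have y0 i : (0 <= y i)%R by rewrite mulr_ge0.
have sumy (z : nat -> R) : ((\sum_(i < N) y i * z i) / N%:R = \sum_(i < N) `|q i| * z i)%R.
  rewrite mulr_suml; apply: eq_bigr => i _.
  by rewrite /y mulrAC mulfK ?gt_eqF.
have yz (z : nat -> R) : (forall i, 0 <= z i)%R ->
    ((\sum_(i < N) y i * z i) / N%:R <= step_norm N z)%R.
  move=> z0; rewrite sumy.
  (* Testing q on z with the signs of q yields the sum for |q|, while the absolute values of the
     test vector stay below z. *)
  have := qp (fun i => Num.sg (q i) * z i)%R.
  rewrite (_ : (\sum_(i < N) _ = \sum_(i < N) `|q i| * z i)%R); last first.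
    by apply: eq_bigr => i _; rewrite mulrA (mulrC (q i)) -normrEsg.
  move=> /le_trans; apply; apply: (step_norm_le ri) => // i _.
  rewrite normrM (ger0_norm (z0 i)) normr_sg ler_piMl//.
  by case: (_ != _); rewrite /= ?ler01.
have one0 (i : nat) : (0 <= 1 :> R)%R by [].
have x1 : step_norm N (fun i => x i + 1)%R = (step_norm N x + 1)%R.
  apply: EFin_inj; rewrite EFinD -!(step_normE ri)//; last by move=> i; rewrite addr_ge0.
  rewrite -(eqv _ 1%R (step_Mplus N0 x0)); last first.
    by move=> w _; apply: adde_ge0 => //; exact: step_ge0.
  apply: (norm_eq ri).
  - by apply: step_Mplus => // i; rewrite addr_ge0.
  - by apply: MplusD => //; exact: step_Mplus.
  by move=> w w01; rewrite stepD {2}/step w01.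
have sone : step_norm N (fun=> 1%R) = 1%R by exact: step_norm_cst.
have yx1 : (step_norm N x + 1 <= (\sum_(i < N) y i * x i) / N%:R + (\sum_(i < N) y i * 1) / N%:R)%R.
  rewrite -x1 -mulrDl -big_split/=.
  under eq_bigr do rewrite -mulrDr.
  rewrite (sumy (fun i => x i + 1)%R).
  rewrite (_ : step_norm N _ = p (fun i => x i + 1)%R).
    rewrite -qx; apply: ler_sum => i _; rewrite ler_wpM2r ?addr_ge0//.
    exact: ler_norm.
  by apply: (step_norm_eq ri) => // i *; rewrite ?addr_ge0// ger0_norm ?addr_ge0.
have yx := yz x x0; have y1 := yz (fun=> 1%R) one0; rewrite sone in y1.
have [Eyx Ey1] := eq_of_leD yx y1 yx1.
exists y; split => // [i j ijN|]; last first.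
  by move: Ey1; under eq_bigr do rewrite mulr1.
have [ij|] := ltnP i j; last first.
  by case/andP: ijN => ij _ ji; rewrite (@anti_leq i j) ?ij.
have ijN' : (i < j < N)%N by rewrite ij; case/andP: ijN.
have /andP[_ jN] := ijN; have iN := ltn_trans ij jN.
(* The pairing of y with the swapped vector is at most the common norm, so (y i - y j)(x i - x j) >=
   0, where x i > x j. *)
have xs : step_norm N (fun k => x (swap i j k)) = step_norm N x.
  apply: (step_norm_reindex ri) => //.
    by move=> k kN; rewrite /swap; case: ifP => // _; case: ifP.
  by move=> k k' _ _; exact: (inv_inj (swapK i j)).
have := yz (fun k => x (swap i j k)) (fun k => x0 _).
rewrite xs -Eyx ler_pM2r ?invr_gt0// -subr_ge0 sum_swap//.
by rewrite pmulr_lge0 ?subr_ge0// subr_gt0 xd.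
Qed.

End associate.

(** * The two implications *)

Section representation.
Context {R : realType} (rho : (R -> \bar R) -> \bar R) (ri : ri_function_norm rho).
Local Notation mu := (@mu R).
Local Notation Omega := (@Omega R).
Local Notation step_norm := (step_norm rho).
Implicit Types (X Y Z : R -> \bar R) (x y z : nat -> R) (N M : nat).

(** On [0,1[ the rearrangement of X + c is X^* + c, and at 1 the factor Y^* vanishes. The extra term
    is c times the integral of Y^*, which is at least c E[Y] = c. *)
Lemma pairingD X Y (c : R) : Mplus X -> Mplus Y -> (0 <= c)%R ->
  Defs.expectation Y = 1 -> pairing X Y + c%:E <= pairing (fun w => X w + c%:E) Y.
Proof.
move=> MX MY c0 EY; have [mX' _] := Mplus_rearr MX; have [mY' _] := Mplus_rearr MY.
have mO := @measurable_Omega R.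
have -> : pairing (fun w => X w + c%:E) Y =
    \int[mu]_(w in Omega) (rearr X w * rearr Y w + c%:E * rearr Y w).
  apply: eq_integral => w; rewrite inE => /Omega_split[w01|->].
    by rewrite rearrD// ge0_muleDl ?rearr_ge0.
  by rewrite (rearr_ge1 MY)// !mule0 adde0.
rewrite ge0_integralD; [|exact: mO| | | |]; first last.
- by apply: measurable_funeM.
- by move=> w _; rewrite mule_ge0 ?rearr_ge0.
- exact: emeasurable_funM.
- by move=> w _; rewrite mule_ge0 ?rearr_ge0.
rewrite leeD2l// ge0_integralZl_EFin; [|exact: mO| |exact: mY'|exact: c0]; last first.
  by move=> w _; exact: rearr_ge0.
rewrite -[leLHS]mule1 -EY; apply: lee_wpmul2l; first by rewrite lee_fin.
exact: le_integral_rearr.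
Qed.

Lemma translation_of_representation X (c : R) : has_representation rho ->
  Mplus X -> (0 <= c)%R -> rho (fun w => X w + c%:E) = rho X + c%:E.
Proof.
move=> rep MX c0; have MXc := MplusD MX c0; apply/le_anti/andP; split.
  by rewrite -{2}(norm_cst ri c0); apply: (normD ri) => //; exact: Mplus_cst.
rewrite -leeBrDr// [leLHS]rep//; apply: ge_ereal_sup => _ [Y [MY [EY Y1]] <-].
rewrite leeBrDr//; apply: le_trans (pairingD MX MY c0 EY) _.
by rewrite [leRHS]rep//; apply: ereal_sup_ubound; exists Y.
Qed.

Lemma pos_translation_equivariant_of_representation :
  has_representation rho -> pos_translation_equivariant rho.
Proof.
move=> rep X c MX Xc0; have [c0|c0] := leP 0%R c.
  exact: translation_of_representation.
have MXc : Mplus (fun w => X w + c%:E).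
  by split=> //; apply: emeasurable_funD; [exact: MX.1|exact: measurable_cst].
(* For negative c, the case already treated is applied to X + c and the shift -c. *)
have Nc0 : (0 <= - c)%R by rewrite oppr_ge0 ltW.
have := translation_of_representation rep MXc Nc0.
under eq_fun do rewrite EFinN addeK//.
by move=> ->; rewrite EFinN subeK.
Qed.

(** [norming_vector] wants strictly decreasing coefficients, so e/(i+1) is added to a i. This can
    only raise the norm, and it changes the pairing by at most e because y has mean 1. *)
Lemma norm_step_le_sup X N (a : nat -> R) (e : R) :
  Mplus X -> (0 < N)%N -> (forall i, 0 <= a i)%R ->
  (forall i j, (i <= j)%N -> a j <= a i)%R ->
  (forall w, step N a w <= rearr X w) -> (0 < e)%R ->
  pos_translation_equivariant rho ->
  exists Y, [/\ Mplus Y, Defs.expectation Y = 1, assoc_norm rho Y = 1 &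
    rho (step N a) <= pairing X Y + e%:E].
Proof.
move=> MX N0 a0 ad aX e0 eqv.
have e1 (i : nat) : (0 <= e / i.+1%:R)%R by rewrite divr_ge0// ltW.
have [|i j /andP[ij _]|y [y0 yd y1 yx yz]] :=
  @norming_vector R rho ri N (fun i => a i + e / i.+1%:R)%R N0 _ _ eqv.
- by move=> i; rewrite addr_ge0.
- by rewrite ler_ltD ?ad 1?ltnW// ltr_pM2l// ltf_pV2 ?posrE// ltr_nat ltnS.
have MY := step_Mplus N0 y0.
exists (step N y); split=> //.
- by rewrite /Defs.expectation integral_step// y1.
- apply/le_anti/andP; split; first exact: (assoc_norm_step_le1 ri N0 y0 yd yz).
  by have := assoc_norm_step_ge ri N0 y0 yd; rewrite y1.
rewrite (step_normE ri)//.
apply: (@le_trans _ _ (step_norm N (fun i => a i + e / i.+1%:R)%R)%:E).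
  by rewrite lee_fin; apply: (step_norm_le ri) => // i *; rewrite ?addr_ge0// lerDl.
rewrite -yx; apply: (@le_trans _ _ (((\sum_(i < N) y i * a i) / N%:R)%:E + e%:E)).
  rewrite -EFinD lee_fin; under eq_bigr do rewrite mulrDr.
  rewrite big_split/= mulrDl lerD2l -[leRHS]mulr1 -[X in (_ <= _ * X)%R]y1 mulrA ler_pM2r ?invr_gt0 ?ltr0n//.
  rewrite mulr_sumr; apply: ler_sum => i _; rewrite mulrC ler_wpM2r//.
  by rewrite ler_pdivrMr// ler_peMr ?ler1n// ltW.
have ya0 i : (0 <= y i * a i)%R by rewrite mulr_ge0.
rewrite leeD2r// -(integral_step N0 ya0).
have mO := @measurable_Omega R.
apply: ge0_le_integral.
- exact: mO.
- by move=> w _; exact: step_ge0.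
- exact: measurable_step.
- by apply: emeasurable_funM; exact: (Mplus_rearr _).1.
(* The decreasing step function with coefficients y is its own rearrangement, and the one with
   coefficients a lies below X^*. *)
move=> w wO; rewrite stepM [rearr (step N y) w]rearr_step// muleC.
by apply: lee_wpmul2r; first exact: step_ge0.
Qed.

Lemma representation_of_pos_translation_equivariant :
  pos_translation_equivariant rho -> has_representation rho.
Proof.
move=> eqv X MX; apply/le_anti/andP; split; last first.
  apply: ge_ereal_sup => _ [Y [MY [_ Y1]] <-].
  by apply: (pairing_le_norm ri) => //; rewrite Y1.
(* The dyadic approximations start from the single cell N = 1; it suffices to bound the norm of each
   by the supremum. *)
apply: (cvge_le _ (norm_approx_cvg ri MX (ltnSn 0))); apply: nearW => m.
apply/lee_addgt0Pr => e e0.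
have [|Y [MY EY Y1 XY]] := norm_step_le_sup MX (N2_gt0 m (ltnSn 0))
  (approx_coef_ge0 X 1 m) (@approx_coef_nonincreasing _ X 1 m) _ e0 eqv.
  by move=> w; exact: approx_le_rearr.
apply: le_trans XY _; rewrite leeD2r//.
by apply: ereal_sup_ubound; exists Y.
Qed.

End representation.

Theorem theorem10 (R : realType) (rho : (R -> \bar R) -> \bar R) :
  ri_function_norm rho ->
  (has_representation rho <-> pos_translation_equivariant rho).
Proof.
move=> ri; split.
  exact: pos_translation_equivariant_of_representation.
exact: representation_of_pos_translation_equivariant.
Qed.
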